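(* Let $n\ge 1$ and let $A,B$ be real symmetric positive definite $n\times n$ matrices. Then the squared Bures-Wasserstein distance $\rho^2(A,B)$ is the optimal value of the following semidefinite program in the variable $U\in\mathbb{R}^{n\times n}$: $$\rho^2(A,B)=\min\left\{\operatorname{Tr}(A)+\operatorname{Tr}(B)-2\operatorname{Tr}\left(\sqrt{A}\,U\right)\;:\;U\in\mathbb{R}^{n\times n},\ \begin{bmatrix}B & U^\top\\ U & I\end{bmatrix}\succeq 0\right\}.$$
   Context: For a real symmetric positive definite matrix $X$, $\sqrt{X}$ denotes its unique symmetric positive definite square root. $O(n)$ is the group of real orthogonal $n\times n$ matrices, $\|\cdot\|_F$ is the Frobenius norm, $I$ is the $n\times n$ identity matrix, and $M\succeq 0$ means that the symmetric matrix $M$ is positive semidefinite. The Bures-Wasserstein distance between positive definite matrices $A,B$ is $$\rho(A,B)=\min_{U,V\in O(n)}\left\|\sqrt{A}\,U-\sqrt{B}\,V\right\|_F .$$ *)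

(* Defs.v *)
From mathcomp Require Import all_boot all_order all_algebra.
From mathcomp Require Import boolp classical_sets reals.

Set Implicit Arguments.
Unset Strict Implicit.
Unset Printing Implicit Defensive.

Import Order.TTheory GRing.Theory Num.Theory.

Local Open Scope classical_set_scope.
Local Open Scope ring_scope.

Definition posdefmx (R : realType) (n : nat) (M : 'M[R]_n) : Prop :=
  M \is symmetricmx /\
  forall x : 'cV[R]_n, x != 0 -> 0 < (x^T *m M *m x) 0 0.

Definition possemidefmx (R : realType) (n : nat) (M : 'M[R]_n) : Prop :=
  M \is symmetricmx /\
  forall x : 'cV[R]_n, 0 <= (x^T *m M *m x) 0 0.

(* Meaningful for positive definite X, which has exactly one such root; the
   default value 0 is only returned when there is none. *)
Definition sqrtmx (R : realType) (n : nat) (X : 'M[R]_n) : 'M[R]_n :=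
  xget 0 [set S : 'M[R]_n | posdefmx S /\ S *m S = X].

Definition orthogonal_group (R : realType) (n : nat) : set 'M[R]_n :=
  [set U : 'M[R]_n | U^T *m U = 1%:M /\ U *m U^T = 1%:M].

Definition frobenius_norm (R : realType) (m n : nat) (M : 'M[R]_(m, n)) : R :=
  Num.sqrt (\sum_(i < m) \sum_(j < n) M i j ^+ 2).

Definition is_minimum (R : realType) (E : set R) (m : R) : Prop :=
  E m /\ lbound E m.

(* The minimum of E, when it is attained; the default value 0 is only returned
   when it is not. *)
Definition minimum (R : realType) (E : set R) : R :=
  xget 0 [set m : R | is_minimum E m].

Definition bures_wasserstein (R : realType) (n : nat) (A B : 'M[R]_n) : R :=
  minimum [set frobenius_norm (sqrtmx A *m U - sqrtmx B *m V)
          | U in @orthogonal_group R n & V in @orthogonal_group R n].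

(* Main.v *)
Require Import Defs.
From mathcomp Require Import all_boot all_order all_algebra.
From mathcomp Require Import complex lra.
From mathcomp Require Import boolp classical_sets reals.

Set Implicit Arguments.
Unset Strict Implicit.
Unset Printing Implicit Defensive.

Import Order.TTheory GRing.Theory Num.Theory.

Local Open Scope classical_set_scope.
Local Open Scope ring_scope.

(** Write S and T for the positive definite square roots of A and B, and P for
    that of S B S. Both sides of the claimed equality are equal to
    tr A + tr B - 2 tr P.

    For orthogonal X and Y, expanding the Frobenius norm shows that
    |S X - T Y|^2 is the objective of the semidefinite program at
    W = X Y^T T ([frobenius_norm_sqr_orthogonal]). This W satisfies W^T W = B,
    hence is feasible ([sdp_feasible]). So it is enough to bound the objective
    from below on all feasible points and to reach the bound at one that
    comes from a pair of orthogonal matrices.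

    The bound tr (S U) <= tr P is weak duality: the positive semidefinite block
    matrix is tested against one explicit dual certificate, built from a
    square root of P ([sdp_weak_duality]). Equality holds at U = P S^-1, for
    which U^T U = B and tr (S U) = tr P ([sdp_optimum]); then U T^-1 is
    orthogonal, so U arises from the pair (U T^-1, 1). In particular the minimum
    that defines the distance is attained.

    The existence of positive definite square roots rests on the spectral theorem
    over the complex numbers. It shows that a real symmetric matrix is
    annihilated by every real polynomial vanishing on its eigenvalues
    ([symmetric_spectrum]), so a square root can be obtained by evaluating
    at the matrix a polynomial that interpolates roots of the eigenvalues
    ([posdefmx_sqrt_exists]). *)

(** * Quadratic forms *)

Lemma symmetricmxP (R : fieldType) (n : nat) (M : 'M[R]_n) :
  reflect (M^T = M) (M \is symmetricmx).
Proof.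
rewrite is_hermitianmxE expr0 scale1r map_mx_id //.
by rewrite eq_sym; exact: eqP.
Qed.

Lemma posdefmx_tr (R : realType) (n : nat) (M : 'M[R]_n) :
  posdefmx M -> M^T = M.
Proof. by case=> /symmetricmxP. Qed.

Lemma gram_col (R : realType) (n : nat) (x : 'cV[R]_n) :
  (x^T *m x) 0 0 = \sum_i x i 0 ^+ 2.
Proof. by rewrite mxE; apply: eq_bigr => i _; rewrite mxE expr2. Qed.

Lemma gram_col_ge0 (R : realType) (n : nat) (x : 'cV[R]_n) :
  0 <= (x^T *m x) 0 0.
Proof. by rewrite gram_col sumr_ge0 // => i _; exact: sqr_ge0. Qed.

Lemma gram_col_gt0 (R : realType) (n : nat) (x : 'cV[R]_n) :
  x != 0 -> 0 < (x^T *m x) 0 0.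
Proof.
move=> x0; rewrite lt_def gram_col_ge0 andbT; apply: contra x0.
rewrite gram_col psumr_eq0 => [|i _]; last exact: sqr_ge0.
move=> /allP x0; apply/eqP/colP => i; rewrite mxE.
by apply/eqP; rewrite -sqrf_eq0; apply: x0; rewrite mem_index_enum.
Qed.

Lemma posdefmx_unit (R : realType) (n : nat) (M : 'M[R]_n) :
  posdefmx M -> M \in unitmx.
Proof.
case=> _ Mpos; rewrite unitmxE unitfE; apply/negP => /det0P[v v0 vM].
have := Mpos v^T; rewrite trmxK vM mul0mx mxE ltxx trmx_eq0 => /(_ v0).
by [].
Qed.

Lemma unitmx_mul_neq0 (R : realType) (n : nat) (T : 'M[R]_n) (x : 'cV[R]_n) :
  T \in unitmx -> x != 0 -> T *m x != 0.
Proof.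
move=> uT; apply: contra => /eqP Tx0.
by rewrite -(mulKmx uT x) Tx0 mulmx0.
Qed.

Lemma posdefmx_congr (R : realType) (n : nat) (M T : 'M[R]_n) :
  posdefmx M -> T \in unitmx -> posdefmx (T^T *m M *m T).
Proof.
move=> hM uT; split.
  by apply/symmetricmxP; rewrite !trmx_mul trmxK (posdefmx_tr hM) mulmxA.
move=> x x0; have [_ /(_ _ (unitmx_mul_neq0 uT x0))] := hM.
by rewrite trmx_mul !mulmxA.
Qed.

Lemma posdefmx_gram (R : realType) (n : nat) (T : 'M[R]_n) :
  T \in unitmx -> posdefmx (T^T *m T).
Proof.
move=> uT; rewrite -[T^T]mulmx1; apply: posdefmx_congr => //; split.
  by apply/symmetricmxP; rewrite trmx1.
by move=> x x0; rewrite mulmx1 gram_col_gt0.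
Qed.

(** Each diagonal entry of Z^T M Z is the quadratic form of M at a column of Z. *)
Lemma possemidefmx_trace_ge0 (R : realType) (m n : nat) (M : 'M[R]_m)
    (Z : 'M[R]_(m, n)) :
  possemidefmx M -> 0 <= \tr (Z^T *m M *m Z).
Proof.
case=> _ Mpos; rewrite /mxtrace; apply: sumr_ge0 => i _.
by have := Mpos (col i Z); rewrite tr_col -row_mul colE mulmxA -colE -row_mul 2!mxE.
Qed.

(** * Square roots of positive definite matrices *)

(** Newton's scheme: a multiple of the product of the X - a, for a among the
    nodes already treated, corrects the value at a new node without changing
    the others. *)
Lemma exists_interpolation (F : fieldType) (f : F -> F) (s : seq F) :
  exists q : {poly F}, forall x, x \in s -> q.[x] = f x.
Proof.
elim: s => [|y s [q qs]]; first by exists 0.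
have [ys|ys] := boolP (y \in s).
  by exists q => x; rewrite inE => /predU1P[->|/qs//]; exact: qs.
pose w := \prod_(a <- s) ('X - a%:P).
have wy : w.[y] != 0 by rewrite -/(root w y) root_prod_XsubC.
exists (q + ((f y - q.[y]) / w.[y]) *: w) => x.
rewrite inE hornerD hornerZ => /predU1P[->|xs].
  by rewrite divfK // addrC subrK.
have /rootP -> : root w x by rewrite root_prod_XsubC.
by rewrite mulr0 addr0 qs.
Qed.

Lemma trmx_horner_mx (R : comNzRingType) (n : nat) (A : 'M[R]_n.+1)
    (q : {poly R}) :
  (horner_mx A q)^T = horner_mx A^T q.
Proof.
elim/poly_ind: q => [|q c IH]; first by rewrite !raddf0.
rewrite !rmorphD !rmorphM /= !horner_mx_X !horner_mx_C raddfD /= tr_scalar_mx.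
congr (_ + _); rewrite -!mulmxE trmx_mul IH.
by apply/esym; apply: comm_horner_mx.
Qed.

(** The spectral theorem in a form that only mentions real data. Over the complex
    numbers A is similar to a diagonal matrix with real entries; these are
    eigenvalues of A over R, because they are roots of its characteristic
    polynomial, and q (A) is similar to the diagonal matrix of the values of q at
    them. *)
Lemma symmetric_spectrum (R : realType) (n : nat) (A : 'M[R]_n.+1) :
  A^T = A ->
  exists s : seq R, {in s, forall a, eigenvalue A a} /\
    forall q : {poly R}, {in s, forall a, root q a} -> horner_mx A q = 0.
Proof.
move=> Asym; pose f := real_complex R; pose AC := map_mx f A.
have hAC : AC \is hermsymmx.
  apply: realsym_hermsym; first by apply/symmetricmxP; rewrite map_trmx Asym.
  by apply/mxOverP => i j; rewrite mxE; apply/complex_realP; exists (A i j).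
have := hermitian_spectral_diag_real hAC.
have /hermitian_normalmx/orthomx_spectralP := hAC.
have := spectral_unit AC.
move: (spectralmx AC) (spectral_diag AC) => P D uP eqA Dreal.
have DE i : D 0 i = f (complex.Re (D 0 i)).
  by rewrite /f RRe_real //; move/mxOverP: Dreal; exact.
exists [seq complex.Re (D 0 i) | i : 'I_n.+1]; split.
  move=> _ /mapP[i _ ->].
  suff: eigenvalue AC (D 0 i).
    rewrite eigenvalue_root_char -map_char_poly DE fmorph_root.
    by rewrite -eigenvalue_root_char.
  apply/eigenvalueP; exists (row i P).
    rewrite -row_mul {1}eqA !mulmxA mulmxV // mul1mx mul_diag_mx.
    by apply/rowP => j; rewrite !mxE.
  apply/negP => /eqP Pi0.
  have := row_mul i P (invmx P); rewrite mulmxV // Pi0 mul0mx row1.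
  by move/rowP/(_ i); rewrite !mxE !eqxx => /eqP; rewrite oner_eq0.
move=> q qroot; apply: (map_mx_inj (f := f)).
rewrite map_horner_mx -/AC eqA horner_mx_uconjC // horner_mx_diag map_mx0.
suff -> : map_mx (horner (map_poly f q)) D = 0.
  by rewrite raddf0 mulmx0 mul0mx.
apply/rowP => i; rewrite !mxE DE horner_map.
have /rootP -> : root q (complex.Re (D 0 i)).
  by apply/qroot/mapP; exists i; rewrite ?mem_enum.
by rewrite rmorph0.
Qed.

Lemma posdefmx_eigenvalue_gt0 (R : realType) (n : nat) (A : 'M[R]_n) (a : R) :
  posdefmx A -> eigenvalue A a -> 0 < a.
Proof.
move=> [_ Apos] /eigenvalueP[v vA v0].
have v0' : v^T != 0 by rewrite trmx_eq0.
have := Apos _ v0'; rewrite trmxK vA -scalemxAl mxE pmulr_lgt0 //.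
by have := gram_col_gt0 v0'; rewrite trmxK.
Qed.

(** A polynomial in A that squares to A is symmetric, but need not be positive
    definite. So a fourth root T of A is interpolated instead: its square is a
    square root of A and also the Gram matrix of the invertible symmetric T,
    hence positive definite. *)
Lemma posdefmx_sqrt_exists (R : realType) (n : nat) (A : 'M[R]_n) :
  posdefmx A -> exists S : 'M[R]_n, posdefmx S /\ S *m S = A.
Proof.
case: n A => [|n] A hA; first by exists A; split=> //; rewrite !(flatmx0 _).
have Asym := posdefmx_tr hA.
have [s [s_eig s_ann]] := symmetric_spectrum Asym.
have [q qE] := exists_interpolation (fun a => Num.sqrt (Num.sqrt a)) s.
pose T := horner_mx A q.
have Tsym : T^T = T by rewrite trmx_horner_mx Asym.
have T4 : T *m T *m (T *m T) = A.
  apply/eqP; rewrite -subr_eq0; apply/eqP.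
  have -> : T *m T *m (T *m T) - A = horner_mx A (q * q * (q * q) - 'X).
    by rewrite rmorphB !rmorphM /= horner_mx_X.
  apply: s_ann => a sa; have a0 := posdefmx_eigenvalue_gt0 hA (s_eig a sa).
  rewrite /root hornerD hornerN !hornerM hornerX qE // -!expr2.
  by rewrite !sqr_sqrtr ?sqrtr_ge0 ?ltW // subrr.
have uT : T \in unitmx.
  by have := posdefmx_unit hA; rewrite -T4 !unitmx_mul => /andP[/andP[]].
by exists (T *m T); split=> //; rewrite -{1}Tsym; exact: posdefmx_gram.
Qed.

Lemma sqrtmxP (R : realType) (n : nat) (A : 'M[R]_n) :
  posdefmx A -> posdefmx (sqrtmx A) /\ sqrtmx A *m sqrtmx A = A.
Proof.
move=> /posdefmx_sqrt_exists[S hS]; rewrite /sqrtmx.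
by case: xgetP => [S' _ //|/(_ S)]; case.
Qed.

(** * The semidefinite program *)

(** The block matrix is then the Gram matrix of the columns of [U I]. *)
Lemma sdp_feasible (R : realType) (n : nat) (B U : 'M[R]_n) :
  U^T *m U = B -> possemidefmx (block_mx B U^T U 1%:M).
Proof.
move=> UB; have -> : block_mx B U^T U 1%:M = (row_mx U 1%:M)^T *m row_mx U 1%:M.
  by rewrite tr_row_mx mul_col_row trmx1 mulmx1 !mul1mx UB.
split=> [|x]; first by apply/symmetricmxP; rewrite trmx_mul trmxK.
rewrite -!mulmxA mulmxA -trmx_mul; exact: gram_col_ge0.
Qed.

(** With Q a symmetric square root of P, take the trace of Z^T M Z, where M is the
    block matrix and Z stacks - S Q^-1 over Q. The diagonal blocks of M contribute
    tr (Q^-1 S B S Q^-1) = tr P and tr (Q Q) = tr P, and each off-diagonal block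
    contributes - tr (S U), so 0 <= 2 tr P - 2 tr (S U). *)
Lemma sdp_weak_duality (R : realType) (n : nat) (S B P U : 'M[R]_n) :
  S^T = S -> posdefmx P -> P *m P = S *m B *m S ->
  possemidefmx (block_mx B U^T U 1%:M) -> \tr (S *m U) <= \tr P.
Proof.
move=> Ssym hP PP hU.
have [Q [hQ QQ]] := posdefmx_sqrt_exists hP.
have uQ := posdefmx_unit hQ; have Qsym := posdefmx_tr hQ.
have := possemidefmx_trace_ge0 (col_mx (- (S *m invmx Q)) Q) hU.
rewrite tr_col_mx mul_row_block mul_row_col.
rewrite [(- _)^T]linearN /= trmx_mul trmx_inv Qsym Ssym mulmx1.
rewrite !mulmxDl !mulmxN !mulNmx !mxtraceD opprK !raddfN /=.
have -> : \tr (invmx Q *m S *m B *m (S *m invmx Q)) = \tr P.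
  have -> : invmx Q *m S *m B *m (S *m invmx Q) =
            invmx Q *m (S *m B *m S) *m invmx Q by rewrite !mulmxA.
  by rewrite -PP -QQ -!mulmxA mulmxV // mulmx1 mulKmx.
have -> : \tr (Q *m U *m (S *m invmx Q)) = \tr (S *m U).
  by rewrite mxtrace_mulC mulmxA mulmxKV // -mulmxA.
have -> : \tr (invmx Q *m S *m U^T *m Q) = \tr (S *m U).
  rewrite mxtrace_mulC !mulmxA mulmxV // mul1mx -mxtrace_tr trmx_mul trmxK Ssym.
  by rewrite mxtrace_mulC.
rewrite QQ => h; lra.
Qed.

(** This U meets the bound of [sdp_weak_duality], and it also satisfies the
    constraint U^T U <= B with equality, so that it is an orthogonal matrix times
    a square root of B. *)
Lemma sdp_optimum (R : realType) (n : nat) (S B P : 'M[R]_n) :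
  S^T = S -> S \in unitmx -> P^T = P -> P *m P = S *m B *m S ->
  let U := P *m invmx S in U^T *m U = B /\ \tr (S *m U) = \tr P.
Proof.
move=> Ssym uS Psym PP /=; split.
  rewrite trmx_mul trmx_inv Ssym Psym mulmxA -(mulmxA _ P P) PP.
  by rewrite -!mulmxA mulmxV // mulmx1 mulmxA mulVmx // mul1mx.
by rewrite mxtrace_mulC -mulmxA mulVmx // mulmx1.
Qed.

(** * The Bures-Wasserstein distance *)

Lemma frobenius_norm_sqr (R : realType) (m n : nat) (M : 'M[R]_(m, n)) :
  frobenius_norm M ^+ 2 = \tr (M^T *m M).
Proof.
rewrite /frobenius_norm sqr_sqrtr; last first.
  by apply: sumr_ge0 => i _; apply: sumr_ge0 => j _; exact: sqr_ge0.
rewrite exchange_big /mxtrace; apply: eq_bigr => j _; rewrite mxE.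
by apply: eq_bigr => i _; rewrite mxE expr2.
Qed.

(** The last trace is the one of the semidefinite program at the point U V^T T. *)
Lemma frobenius_norm_sqr_orthogonal (R : realType) (n : nat)
    (S T U V : 'M[R]_n) :
  S^T = S -> T^T = T -> orthogonal_group U -> orthogonal_group V ->
  frobenius_norm (S *m U - T *m V) ^+ 2 =
  \tr (S *m S) + \tr (T *m T) - 2 * \tr (S *m (U *m V^T *m T)).
Proof.
move=> Ssym Tsym [_ UU] [_ VV].
rewrite frobenius_norm_sqr [(_ - _)^T]raddfB /= mulmxBl !mulmxBr !trmx_mul Ssym Tsym.
rewrite !raddfB /= -!(mulmxA _ S) -!(mulmxA _ T).
rewrite !(mxtrace_mulC U^T) !(mxtrace_mulC V^T).
have -> : S *m (S *m U) *m U^T = S *m S by rewrite -!mulmxA UU mulmx1.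
have -> : T *m (T *m V) *m V^T = T *m T by rewrite -!mulmxA VV mulmx1.
have -> : \tr (T *m (S *m U) *m V^T) = \tr (S *m (U *m V^T *m T)).
  by rewrite -mulmxA mxtrace_mulC -!mulmxA.
have -> : \tr (S *m (T *m V) *m U^T) = \tr (S *m (U *m V^T *m T)).
  rewrite -mxtrace_tr !trmx_mul trmxK Ssym Tsym.
  by rewrite mulmxA mxtrace_mulC !mulmxA.
lra.
Qed.

Lemma minimum_unique (R : realType) (E : set R) (m : R) :
  is_minimum E m -> minimum E = m.
Proof.
move=> [Em lbm]; rewrite /minimum.
case: xgetP => [k _ [Ek lbk]|/(_ m)]; last by case.
by apply/le_anti; rewrite lbm // lbk.
Qed.

Theorem mainTheorem1 (R : realType) (n : nat) (hn : (1 <= n)%N)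
    (A B : 'M[R]_n) (hA : posdefmx A) (hB : posdefmx B) :
  is_minimum
    [set \tr A + \tr B - 2 * \tr (sqrtmx A *m U)
    | U in [set U : 'M[R]_n | possemidefmx (block_mx B U^T U 1%:M)]]
    (bures_wasserstein A B ^+ 2).
Proof.
have [] := sqrtmxP hA; have [] := sqrtmxP hB; rewrite /bures_wasserstein.
move: (sqrtmx A) (sqrtmx B) => S T hT TT hS SS.
have Ssym := posdefmx_tr hS; have uS := posdefmx_unit hS.
have Tsym := posdefmx_tr hT; have uT := posdefmx_unit hT.
have hSBS : posdefmx (S *m B *m S) by rewrite -{1}Ssym; exact: posdefmx_congr.
have [P [hP PP]] := posdefmx_sqrt_exists hSBS.
have [UB trU] := sdp_optimum Ssym uS (posdefmx_tr hP) PP.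
move: (P *m invmx S) UB trU => U UB trU.
pose c := \tr A + \tr B - 2 * \tr P.
have le_c W : W^T *m W = B -> c <= \tr A + \tr B - 2 * \tr (S *m W).
  move=> /sdp_feasible/(sdp_weak_duality Ssym hP PP); rewrite /c => h; lra.
(* The orthogonal factor of the optimal point: U = W T. *)
pose W := U *m invmx T.
have WW : W^T *m W = 1%:M.
  rewrite trmx_mul trmx_inv Tsym -mulmxA (mulmxA U^T) UB -TT.
  by rewrite -mulmxA mulmxV // mulmx1 mulVmx.
have oW : orthogonal_group W by split=> //; exact: mulmx1C.
have o1 : orthogonal_group (1%:M : 'M[R]_n) by split; rewrite trmx1 mulmx1.
have normW : frobenius_norm (S *m W - T *m 1%:M) ^+ 2 = c.
  by rewrite frobenius_norm_sqr_orthogonal // trmx1 mulmx1 mulmxKV // SS TT trU.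
rewrite (minimum_unique (m := frobenius_norm (S *m W - T *m 1%:M))).
  rewrite normW; split; first by exists U; [exact: sdp_feasible|rewrite trU].
  move=> _ [V hV <-]; have := sdp_weak_duality Ssym hP PP hV.
  rewrite /c => h; lra.
split; first by exists W => //; exists 1%:M.
move=> _ [X oX [Y oY <-]].
rewrite -ler_sqr ?nnegrE ?sqrtr_ge0 // normW frobenius_norm_sqr_orthogonal //.
rewrite SS TT; apply: le_c.
case: oX => XX _; case: oY => _ YY.
rewrite !trmx_mul trmxK Tsym !mulmxA -(mulmxA _ X^T) XX mulmx1.
by rewrite -(mulmxA T) YY mulmx1.
Qed.
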